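(* Let $(X,\cdot,\mathbb{C})$ be a pretopological $\top$-convergence group and let $L$ be an MV-algebra, i.e. $a\vee b=(a\to b)\to b$ for all $a,b\in L$. Then $(X,\mathbb{C})$ is a topological $\top$-convergence space.
   Context: Throughout, $L=(L,\ast)$ is a complete residuated lattice: $(L,\le)$ is a complete lattice with top $\top$ and bottom $\bot$, and $\ast$ is a commutative associative binary operation on $L$ with $a\ast\bigvee_{j}b_j=\bigvee_j(a\ast b_j)$ and $a\ast\top=a$. Put $a\to b=\bigvee\{c\in L: a\ast c\le b\}$. $L^X$ is the set of all maps $X\to L$, with pointwise order and operations. For $\lambda,\mu\in L^X$, $S_X(\lambda,\mu)=\bigwedge_{x\in X}(\lambda(x)\to\mu(x))$. A $\top$-filter on $X$ is a nonempty $\mathbb{F}\subseteq L^X$ such that: $\bigvee_{x\in X}\lambda(x)=\top$ for all $\lambda\in\mathbb{F}$; $\lambda\wedge\mu\in\mathbb{F}$ for all $\lambda,\mu\in\mathbb{F}$; and for $\lambda\in L^X$, $\bigvee_{\mu\in\mathbb{F}}S_X(\mu,\lambda)=\top$ implies $\lambda\in\mathbb{F}$. $\mathbb{F}_L^\top(X)$ is the set of $\top$-filters on $X$. For $x\in X$, $[x]_\top=\{\mu\in L^X:\mu(x)=\top\}$ (a $\top$-filter). For a map $f:X\to Y$ and $\mathbb{F}\in\mathbb{F}_L^\top(X)$, $f^\Rightarrow(\mathbb{F})=\{\mu\in L^Y:\mu\circ f\in\mathbb{F}\}\in\mathbb{F}_L^\top(Y)$. A $\top$-convergence space is a pair $(X,\mathbb{C})$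 with $\mathbb{C}:\mathbb{F}_L^\top(X)\to 2^X$, writing $\mathbb{F}\stackrel{\mathbb{C}}{\dashrightarrow}x$ for $x\in\mathbb{C}(\mathbb{F})$, such that (TC1) $[x]_\top\stackrel{\mathbb{C}}{\dashrightarrow}x$ for all $x\in X$; (TC2) $\mathbb{F}\subseteq\mathbb{G}$ and $\mathbb{F}\stackrel{\mathbb{C}}{\dashrightarrow}x$ imply $\mathbb{G}\stackrel{\mathbb{C}}{\dashrightarrow}x$. A map $f:(X,\mathbb{C}_X)\to(Y,\mathbb{C}_Y)$ is continuous if $\mathbb{F}\stackrel{\mathbb{C}_X}{\dashrightarrow}x$ implies $f^\Rightarrow(\mathbb{F})\stackrel{\mathbb{C}_Y}{\dashrightarrow}f(x)$. The product structure $\mathbb{C}\times\mathbb{C}$ on $X\times X$ is given by $\mathbb{F}\stackrel{\mathbb{C}\times\mathbb{C}}{\dashrightarrow}(x_1,x_2)$ iff $p_i^\Rightarrow(\mathbb{F})\stackrel{\mathbb{C}}{\dashrightarrow}x_i$ for $i=1,2$, where $p_1,p_2$ are the projections. For a $\top$-convergence space $(X,\mathbb{C})$ and $x\in X$ put $\mathbb{U}_x=\bigcap\{\mathbb{F}\in\mathbb{F}_L^\top(X):\mathbb{F}\stackrel{\mathbb{C}}{\dashrightarrow}x\}$ (a $\top$-filter). The space is pretopological if (PT) $\mathbb{U}_x\stackrel{\mathbb{C}}{\dashrightarrow}x$ for all $x\in X$. A pretopological $\top$-convergence space is topological if (TT): for all $x\in X$ and all $\lambda\in\mathbb{U}_x$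 there exists $\lambda^\ast\in\mathbb{U}_x$ with $\lambda^\ast\le\lambda$ such that for each $z\in X$ there exists $\lambda_z\in\mathbb{U}_z$ with $\lambda^\ast(z)\le S_X(\lambda_z,\lambda)$. For a group $(X,\cdot)$ and a $\top$-convergence space $(X,\mathbb{C})$, the triple $(X,\cdot,\mathbb{C})$ is a $\top$-convergence group if $m:(X\times X,\mathbb{C}\times\mathbb{C})\to(X,\mathbb{C})$, $(x,y)\mapsto xy$, and $r:(X,\mathbb{C})\to(X,\mathbb{C})$, $x\mapsto x^{-1}$, are continuous. It is a pretopological $\top$-convergence group if moreover $(X,\mathbb{C})$ is pretopological. *)

(* Defs.v *)
From HB Require Import structures.
From mathcomp Require Import all_boot all_order.
From mathcomp Require Import all_classical.

Set Implicit Arguments.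
Unset Strict Implicit.
Unset Printing Implicit Defensive.

Import Order.TTheory.

Local Open Scope classical_set_scope.
Local Open Scope order_scope.

HB.mixin Record Lattice_isComplete d L of Order.TBLattice d L := {
  supremums_neq0 : forall A : set L, supremums A !=set0;
  infimums_neq0 : forall A : set L, infimums A !=set0;
}.

#[short(type="completeLatticeType")]
HB.structure Definition CompleteLattice d :=
  {L of Order.TBLattice d L & Lattice_isComplete d L}.

(* The default values give the supremum and infimum of the empty set. *)
Definition csup d (L : completeLatticeType d) (A : set L) : L :=
  supremum \bot A.
Definition cinf d (L : completeLatticeType d) (A : set L) : L :=
  infimum \top A.

HB.mixin Record CompleteLattice_isResiduated d L of CompleteLattice d L := {
  tensor : L -> L -> L;
  tensorC : commutative tensor;
  tensorA : associative tensor;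
  tensor1 : right_id \top tensor;
  tensor_sup : forall (a : L) (A : set L),
    tensor a (csup A) = csup [set tensor a b | b in A];
}.

#[short(type="completeResiduatedLatticeType")]
HB.structure Definition CompleteResiduatedLattice d :=
  {L of CompleteLattice d L & CompleteLattice_isResiduated d L}.

Definition residuum d (L : completeResiduatedLatticeType d) (a b : L) : L :=
  csup [set c : L | tensor a c <= b].

Definition is_MV d (L : completeResiduatedLatticeType d) : Prop :=
  forall a b : L, a `|` b = residuum (residuum a b) b.

Section CompleteLatticeTheory.
Context d (L : completeLatticeType d).
Implicit Types (A B : set L) (a b : L).

Lemma csupP A : supremums A (csup A).
Proof.
rewrite /csup /supremum; case: ifPn => [/eqP -> | _].
  by split => [x []|x _]; rewrite ?le0x.
by case: xgetP => // noA; have [x /noA] := supremums_neq0 A.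
Qed.

Lemma cinfP A : infimums A (cinf A).
Proof.
rewrite /cinf /infimum; case: ifPn => [/eqP -> | _].
  by split => [x []|x _]; rewrite ?lex1.
by case: xgetP => // noA; have [x /noA] := infimums_neq0 A.
Qed.

Lemma csup_ub A a : A a -> a <= csup A.
Proof. by case: (csupP A) => + _; apply. Qed.

Lemma csup_le A b : (forall a, A a -> a <= b) -> csup A <= b.
Proof. by case: (csupP A) => _; apply. Qed.

Lemma cinf_lb A a : A a -> cinf A <= a.
Proof. by case: (cinfP A) => + _; apply. Qed.

Lemma cinf_ge A b : (forall a, A a -> b <= a) -> b <= cinf A.
Proof. by case: (cinfP A) => _; apply. Qed.

Lemma csup_eq1 A B : (forall a, A a -> exists2 b, B b & a <= b) ->
  csup A = \top -> csup B = \top.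
Proof.
move=> AB A1; apply/eqP; rewrite -le1x -A1; apply: csup_le => a /AB[b Bb ab].
exact: le_trans ab (csup_ub Bb).
Qed.

End CompleteLatticeTheory.

Section Subsethood.
Context d (L : completeResiduatedLatticeType d).

Definition subsethood (X : Type) (l m : X -> L) : L :=
  cinf (range (fun x => residuum (l x) (m x))).

Lemma le_residuum (a b c : L) : tensor a c <= b -> c <= residuum a b.
Proof. exact: csup_ub. Qed.

Lemma residuum_top (b : L) : residuum \top b = b.
Proof.
apply/eqP; rewrite eq_le; apply/andP; split; last first.
  by apply: le_residuum; rewrite tensorC tensor1.
by apply: csup_le => c /=; rewrite tensorC tensor1.
Qed.

Lemma subsethood_le1 X (l m : X -> L) : (l <= m) -> subsethood l m = \top.
Proof.
move=> /lefP lm; apply/eqP; rewrite -le1x; apply: cinf_ge => _ [x _ <-].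
by apply: le_residuum; rewrite tensor1.
Qed.

Lemma subsethood_comp X Y (f : X -> Y) (l m : Y -> L) :
  subsethood l m <= subsethood (l \o f) (m \o f).
Proof. by apply: cinf_ge => _ [x _ <-]; apply: cinf_lb; exists (f x). Qed.

End Subsethood.

Record topFilter d (L : completeResiduatedLatticeType d) (X : Type) :=
  TopFilter {
  topFilter_set :> (X -> L) -> Prop;
  topFilter_neq0 : topFilter_set !=set0;
  topFilter_sup : forall l, topFilter_set l -> csup (range l) = \top;
  topFilter_meet : forall l m,
    topFilter_set l -> topFilter_set m -> topFilter_set (l `&` m);
  topFilter_sat : forall l,
    csup [set subsethood m l | m in topFilter_set] = \top -> topFilter_set l;
}.

Section TopFilters.
Context d (L : completeResiduatedLatticeType d).

Lemma topFilter_top X (F : topFilter L X) : F (fun=> \top).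
Proof.
have [m Fm] := topFilter_neq0 F; apply: topFilter_sat.
apply/eqP; rewrite -le1x; apply: csup_ub; exists m => //.
by apply: subsethood_le1; apply/lefP => x; rewrite lex1.
Qed.

Section Point.
Context (X : Type) (x : X).

Let P : set (X -> L) := [set m : X -> L | m x = \top].

Fact point_neq0 : P !=set0.
Proof. by exists (fun=> \top). Qed.

Fact point_sup l : P l -> csup (range l) = \top.
Proof.
by move=> lx; apply/eqP; rewrite -le1x; apply: csup_ub; exists x.
Qed.

Fact point_meet l m : P l -> P m -> P (l `&` m).
Proof. by rewrite /P /= meetfE => -> ->; rewrite meetxx. Qed.

Fact point_sat l : csup [set subsethood m l | m in P] = \top -> P l.
Proof.
move=> l1; apply/eqP; rewrite -le1x -[X in X <= _]l1.
apply: csup_le => _ [m mx <-]; rewrite -[leRHS]residuum_top -mx.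
by apply: cinf_lb; exists x.
Qed.

Definition pointFilter : topFilter L X :=
  TopFilter point_neq0 point_sup point_meet point_sat.

End Point.

Section Image.
Context (X Y : Type) (f : X -> Y) (F : topFilter L X).

Let P : set (Y -> L) := [set m : Y -> L | F (m \o f)].

Fact image_neq0 : P !=set0.
Proof. by exists (fun=> \top); exact: topFilter_top. Qed.

Fact image_sup l : P l -> csup (range l) = \top.
Proof.
move/topFilter_sup; apply: csup_eq1 => _ [x _ <-].
by exists (l (f x)) => //; exists (f x).
Qed.

Fact image_meet l m : P l -> P m -> P (l `&` m).
Proof. exact: topFilter_meet. Qed.

Fact image_sat l : csup [set subsethood m l | m in P] = \top -> P l.
Proof.
move=> l1; apply: topFilter_sat; apply: csup_eq1 l1 => _ [m Fm <-].
exists (subsethood (m \o f) (l \o f)); first by exists (m \o f).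
exact: subsethood_comp.
Qed.

Definition imageFilter : topFilter L Y :=
  TopFilter image_neq0 image_sup image_meet image_sat.

End Image.

End TopFilters.

(* [conv F x] says that [F] converges to [x]. *)
Record topConvergence d (L : completeResiduatedLatticeType d) (X : Type) :=
  TopConvergence {
  conv :> topFilter L X -> set X;
  conv_point : forall x, conv (pointFilter L x) x;
  conv_subset : forall F G : topFilter L X,
    topFilter_set F `<=` topFilter_set G -> forall x, conv F x -> conv G x;
}.

Section TopConvergenceSpaces.
Context d (L : completeResiduatedLatticeType d).

Definition topContinuous (X Y : Type) (CX : topConvergence L X)
    (CY : topConvergence L Y) (f : X -> Y) : Prop :=
  forall F x, CX F x -> CY (imageFilter f F) (f x).

Section Product.
Context (X Y : Type) (CX : topConvergence L X) (CY : topConvergence L Y).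

Let C (F : topFilter L (X * Y)) : set (X * Y) :=
  [set p | CX (imageFilter fst F) p.1 /\ CY (imageFilter snd F) p.2].

Fact prod_point p : C (pointFilter L p) p.
Proof.
split; first exact: conv_subset (conv_point CX p.1).
exact: conv_subset (conv_point CY p.2).
Qed.

Fact prod_subset (F G : topFilter L (X * Y)) :
  topFilter_set F `<=` topFilter_set G -> forall p, C F p -> C G p.
Proof.
move=> FG p [F1 F2]; split.
  by apply: conv_subset F1 => l; exact: FG.
by apply: conv_subset F2 => l; exact: FG.
Qed.

Definition prodConvergence : topConvergence L (X * Y) :=
  TopConvergence prod_point prod_subset.

End Product.

Section Neighborhood.
Context (X : Type) (C : topConvergence L X) (x : X).

Let P : set (X -> L) :=
  \bigcap_(F in [set F : topFilter L X | C F x]) topFilter_set F.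

Fact nbhd_neq0 : P !=set0.
Proof. by exists (fun=> \top) => F _; exact: topFilter_top. Qed.

Fact nbhd_sup l : P l -> csup (range l) = \top.
Proof.
by move=> /(_ _ (conv_point C x)); exact: topFilter_sup.
Qed.

Fact nbhd_meet l m : P l -> P m -> P (l `&` m).
Proof. by move=> Pl Pm F CF; apply: topFilter_meet; [exact: Pl|exact: Pm]. Qed.

Fact nbhd_sat l : csup [set subsethood m l | m in P] = \top -> P l.
Proof.
move=> l1 F CF; apply: topFilter_sat; apply: csup_eq1 l1 => _ [m Pm <-].
by exists (subsethood m l) => //; exists m => //; exact: Pm.
Qed.

Definition nbhdFilter : topFilter L X :=
  TopFilter nbhd_neq0 nbhd_sup nbhd_meet nbhd_sat.

End Neighborhood.

Definition is_pretopological (X : Type) (C : topConvergence L X) : Prop :=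
  forall x, C (nbhdFilter C x) x.

Definition is_topological (X : Type) (C : topConvergence L X) : Prop :=
  is_pretopological C /\
  forall x l, nbhdFilter C x l ->
    exists l', [/\ nbhdFilter C x l', l' <= l &
      forall z, exists2 lz, nbhdFilter C z lz & l' z <= subsethood lz l].

Definition is_topConvergenceGroup (X : groupType) (C : topConvergence L X) :
    Prop :=
  topContinuous (prodConvergence C C) C (fun p : X * X => (p.1 * p.2)%g) /\
  topContinuous C C (fun x : X => (x^-1)%g).

Definition is_pretopologicalGroup (X : groupType) (C : topConvergence L X) :
    Prop :=
  is_topConvergenceGroup C /\ is_pretopological C.

End TopConvergenceSpaces.

(* Main.v *)
Require Import Defs.
From mathcomp Require Import all_boot all_order.
From mathcomp Require Import all_classical.

(** Write [U_x] for the neighbourhood filter at [x], [*] for the tensor and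
[->] for the residuum.  For [l] in [U_x] the witness of topologicality is the
interior of [l],
  [l' z = sup over m in U_z of S(m, l)].

The interior lies in [U_x].  The product filter [U_x * U_1] converges to
[(x, 1)], so continuity of multiplication, together with pretopologicality,
gives [sup S(m o fst /\ n o snd, l o mul) = top] over [m] in [U_x] and [n] in
[U_1].  Currying such a subsethood degree [c], one gets
[c * m z <= S(n, l (z * _))] for every [z]; since left translations are
continuous, the translate [n (z^-1 * _)] is in [U_z], whence
[c * m z <= l' z], that is [c <= S(m, l')].  Saturation of [U_x] concludes
([interior_nbhd]).

The supremum defining [l' z] need not be attained, whereas topologicality asks
for a single [m] in [U_z] with [l' z <= S(m, l)].  This is where the MV
hypothesis enters: with [a = l' z], the map [a -> l] always satisfies
[a <= S(a -> l, l)], and it belongs to [U_z] by saturation as soon as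
[a -> _] commutes with the supremum of the [S(m, l)], which is the case in a
complete MV-algebra ([residuum_sup_top], [interior_attained]). *)

Set Implicit Arguments.
Unset Strict Implicit.
Unset Printing Implicit Defensive.

Import Order.TTheory.

Local Open Scope classical_set_scope.
Local Open Scope order_scope.

(** * Residuation *)

Section Residuation.
Context d (L : completeResiduatedLatticeType d).
Implicit Types (a b c : L) (A B : set L).

Lemma tensor1l a : tensor \top a = a.
Proof. by rewrite tensorC tensor1. Qed.

Lemma le_tensor2l a b c : b <= c -> tensor a b <= tensor a c.
Proof.
(* Monotonicity is distributivity over the supremum of [{b, c}], which is [c]. *)
move=> bc; have -> : c = csup [set b; c].
  apply/eqP; rewrite eq_le csup_ub ?csup_le //=; last by right.
  by move=> _ [->|->].
by rewrite tensor_sup; apply: csup_ub; exists b => //; left.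
Qed.

Lemma le_tensor a b a' b' : a <= a' -> b <= b' -> tensor a b <= tensor a' b'.
Proof.
move=> aa' bb'; apply: le_trans (le_tensor2l a bb') _.
by rewrite tensorC (tensorC a'); exact: le_tensor2l.
Qed.

Lemma tensor_lel a b : tensor a b <= a.
Proof. by rewrite -[leRHS]tensor1 le_tensor2l ?lex1. Qed.

Lemma tensor_ler a b : tensor a b <= b.
Proof. by rewrite tensorC tensor_lel. Qed.

Lemma tensor_residuum a b : tensor a (residuum a b) <= b.
Proof. by rewrite tensor_sup; apply: csup_le => _ [c /= cb <-]. Qed.

Lemma residuum_adj a b c : (c <= residuum a b) = (tensor a c <= b).
Proof.
apply/idP/idP => [cab|]; last exact: le_residuum.
exact: le_trans (le_tensor2l a cab) (tensor_residuum a b).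
Qed.

Lemma residuum_tensor a b c :
  residuum (tensor a b) c = residuum a (residuum b c).
Proof.
apply/eqP; rewrite eq_le; apply/andP; split.
  by rewrite !residuum_adj tensorA (tensorC b a) -residuum_adj.
by rewrite residuum_adj (tensorC a) -tensorA -residuum_adj -residuum_adj.
Qed.

Lemma residuum_exchange a b c :
  residuum a (residuum b c) = residuum b (residuum a c).
Proof. by rewrite -!residuum_tensor tensorC. Qed.

Lemma residuum_le2l a b c : b <= c -> residuum a b <= residuum a c.
Proof.
by move=> bc; rewrite residuum_adj; apply: le_trans (tensor_residuum a b) bc.
Qed.

Lemma residuum_self a : residuum a a = \top.
Proof. by apply/eqP; rewrite -le1x residuum_adj tensor1. Qed.

Lemma csup_tensor_top A B : csup A = \top -> csup B = \top ->
  csup [set tensor a b | a in A & b in B] = \top.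
Proof.
move=> A1 B1; apply/eqP; rewrite -le1x -[leLHS]A1; apply: csup_le => a Aa.
rewrite -[leLHS]tensor1 -B1 tensor_sup; apply: csup_le => _ [b Bb <-].
by apply: csup_ub; exists a => //; exists b.
Qed.

End Residuation.

(** * Complete MV-algebras *)

Section MV.
Context d (L : completeResiduatedLatticeType d).
Hypothesis MV : is_MV L.
Implicit Types a b : L.

Local Notation neg a := (residuum a \bot).

Lemma MV_negK a : neg (neg a) = a.
Proof. by rewrite -(MV a \bot) joinx0. Qed.

Lemma MV_contrapositive a b : residuum (neg b) (neg a) = residuum a b.
Proof. by rewrite residuum_exchange MV_negK. Qed.

(** Divisibility: [a * (a -> b) = a /\ b], here for [b <= a].  The negation of
the left-hand side is [(a -> b) -> neg a = (neg b -> neg a) -> neg a], which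
the MV identity turns into [neg b \/ neg a]. *)
Lemma MV_divisible a b : b <= a -> tensor a (residuum a b) = b.
Proof.
move=> ba; rewrite -[LHS]MV_negK tensorC residuum_tensor.
rewrite -(MV_contrapositive a b) -MV.
suff -> : neg b `|` neg a = neg b by rewrite MV_negK.
apply/join_idPl; rewrite residuum_adj tensorC.
apply: le_trans (le_tensor2l _ ba) _.
by rewrite tensorC tensor_residuum.
Qed.

(** In a complete MV-algebra [a -> _] commutes with nonempty suprema; this is the
case where both sides equal [top].  Put [t = sup (a -> b)].  Divisibility makes meets
distribute over suprema, so that [a <= sup (a /\ b) = a * t].  As [B] is
nonempty, also [neg a <= t], hence
[t = t \/ neg a = (t -> neg a) -> neg a = neg (a * t) -> neg a = top]. *)
Lemma residuum_sup_top a (B : set L) : B !=set0 -> a <= csup B ->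
  csup [set residuum a b | b in B] = \top.
Proof.
move=> [b0 Bb0] aB; set t := csup _.
have tensor_at : tensor a t = a.
  apply/eqP; rewrite eq_le tensor_lel /=.
  rewrite -[leLHS](MV_divisible aB) tensorC tensor_sup.
  apply: csup_le => _ [b Bb <-]; set w := tensor _ b.
  have wa : w <= a.
    apply: le_trans (tensor_residuum (csup B) a).
    by rewrite [leRHS]tensorC; apply: le_tensor2l; exact: csup_ub.
  rewrite -(MV_divisible wa); apply: le_tensor2l.
  apply: le_trans (residuum_le2l a (tensor_ler _ b)) _.
  by apply: csup_ub; exists b.
have neg_le_t : neg a <= t.
  by apply: le_trans (residuum_le2l a (le0x b0)) _; apply: csup_ub; exists b0.
rewrite -(join_idPl neg_le_t) MV -(residuum_tensor t) (tensorC t) tensor_at.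
exact: residuum_self.
Qed.

End MV.

(** * Generated and product filters *)

Section Subsethood.
Context d (L : completeResiduatedLatticeType d) (X : Type).
Implicit Types (l m n : X -> L).

Lemma subsethoodP l m a :
  reflect (forall x, tensor (l x) a <= m x) (a <= subsethood l m).
Proof.
apply: (iffP idP) => [alm x|alm].
  by rewrite -residuum_adj; apply: le_trans alm _; apply: cinf_lb; exists x.
by apply: cinf_ge => _ [x _ <-]; rewrite residuum_adj.
Qed.

Lemma tensor_subsethood l m x : tensor (l x) (subsethood l m) <= m x.
Proof. exact/subsethoodP. Qed.

Lemma subsethood_trans l m n :
  tensor (subsethood l m) (subsethood m n) <= subsethood l n.
Proof.
apply/subsethoodP => x; rewrite tensorA.
apply: le_trans (tensor_subsethood m n x).
by apply: le_tensor => //; exact: tensor_subsethood.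
Qed.

Lemma subsethood_meet l m l' m' :
  tensor (subsethood l m) (subsethood l' m') <= subsethood (l `&` l') (m `&` m').
Proof.
apply/subsethoodP => x; rewrite !meetfE lexI; apply/andP; split.
  apply: le_trans (tensor_subsethood l m x).
  by apply: le_tensor; [exact: leIl|exact: tensor_lel].
apply: le_trans (tensor_subsethood l' m' x).
by apply: le_tensor; [exact: leIr|exact: tensor_ler].
Qed.

Lemma residuum_subsethood a l m :
  residuum a (subsethood l m) <= subsethood l (fun x => residuum a (m x)).
Proof.
apply/subsethoodP => x; rewrite residuum_adj tensorA (tensorC a) -tensorA.
apply: le_trans (tensor_subsethood l m x).
exact/le_tensor2l/tensor_residuum.
Qed.

End Subsethood.

Section Generated.
Context d (L : completeResiduatedLatticeType d) (X : Type).
Variable B : set (X -> L).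
Hypothesis B_neq0 : B !=set0.
Hypothesis B_sup : forall l, B l -> csup (range l) = \top.
Hypothesis B_meet : forall l m, B l -> B m -> B (l `&` m).

Let P : set (X -> L) := [set l | csup [set subsethood m l | m in B] = \top].

Let generated_sub l : B l -> P l.
Proof.
move=> Bl; apply/eqP; rewrite -le1x; apply: csup_ub.
by exists l => //; exact: subsethood_le1.
Qed.

Fact generated_neq0 : P !=set0.
Proof. by have [l /generated_sub] := B_neq0; exists l. Qed.

Fact generated_sup l : P l -> csup (range l) = \top.
Proof.
move=> Pl; apply/eqP; rewrite -le1x -[leLHS]Pl; apply: csup_le => _ [m Bm <-].
rewrite -[leLHS]tensor1 -(B_sup Bm) tensor_sup.
apply: csup_le => _ [_ [x _ <-] <-]; rewrite tensorC.
by apply: le_trans (tensor_subsethood m l x) _; apply: csup_ub; exists x.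
Qed.

Fact generated_meet l m : P l -> P m -> P (l `&` m).
Proof.
move=> Pl Pm; apply: csup_eq1 (csup_tensor_top Pl Pm).
move=> _ [_ [l' Bl' <-] [_ [m' Bm' <-] <-]].
exists (subsethood (l' `&` m') (l `&` m)); last exact: subsethood_meet.
by exists (l' `&` m') => //; exact: B_meet.
Qed.

(** Saturating twice is saturating once, because subsethood is transitive for
the tensor. *)
Fact generated_sat l : csup [set subsethood m l | m in P] = \top -> P l.
Proof.
move=> l1; apply/eqP; rewrite -le1x -[leLHS]l1; apply: csup_le => _ [m Pm <-].
rewrite -[leLHS]tensor1 -[X in tensor _ X]Pm tensor_sup.
apply: csup_le => _ [_ [n Bn <-] <-]; rewrite tensorC.
by apply: le_trans (subsethood_trans n m l) _; apply: csup_ub; exists n.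
Qed.

Definition generatedFilter : topFilter L X :=
  TopFilter generated_neq0 generated_sup generated_meet generated_sat.

Lemma generatedFilter_base l : B l -> generatedFilter l.
Proof. exact: generated_sub. Qed.

End Generated.

Section ProductFilter.
Context d (L : completeResiduatedLatticeType d) (X Y : Type).
Context (F : topFilter L X) (G : topFilter L Y).

Definition rectangle (m : X -> L) (n : Y -> L) : X * Y -> L :=
  (m \o fst) `&` (n \o snd).

Lemma rectangleE m n x y : rectangle m n (x, y) = m x `&` n y.
Proof. by rewrite /rectangle meetfE. Qed.

Let B : set (X * Y -> L) :=
  [set rectangle m n | m in topFilter_set F & n in topFilter_set G].

Fact rectangle_neq0 : B !=set0.
Proof.
exists (rectangle (fun=> \top) (fun=> \top)).
exists (fun=> \top); first exact: topFilter_top.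
by exists (fun=> \top) => //; exact: topFilter_top.
Qed.

(** The meet dominates the tensor, and a tensor of suprema is a supremum of
tensors. *)
Fact rectangle_sup l : B l -> csup (range l) = \top.
Proof.
move=> [m Fm [n Gn <-]].
apply: csup_eq1 (csup_tensor_top (topFilter_sup Fm) (topFilter_sup Gn)).
move=> _ [_ [x _ <-] [_ [y _ <-] <-]].
exists (rectangle m n (x, y)); first by exists (x, y).
by rewrite rectangleE lexI tensor_lel tensor_ler.
Qed.

Fact rectangle_meet l l' : B l -> B l' -> B (l `&` l').
Proof.
move=> [m Fm [n Gn <-]] [m' Fm' [n' Gn' <-]].
exists (m `&` m'); first exact: topFilter_meet.
exists (n `&` n'); first exact: topFilter_meet.
by apply/funext => -[x y]; rewrite meetfE !rectangleE !meetfE meetACA.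
Qed.

Definition productFilter : topFilter L (X * Y) :=
  generatedFilter rectangle_neq0 rectangle_sup rectangle_meet.

Lemma productFilter_fst : topFilter_set F `<=` imageFilter fst productFilter.
Proof.
move=> m Fm; apply: generatedFilter_base; exists m => //.
exists (fun=> \top); first exact: topFilter_top.
by apply/funext => -[x y]; rewrite rectangleE meetx1.
Qed.

Lemma productFilter_snd : topFilter_set G `<=` imageFilter snd productFilter.
Proof.
move=> n Gn; apply: generatedFilter_base; exists (fun=> \top).
  exact: topFilter_top.
by exists n => //; apply/funext => -[x y]; rewrite rectangleE meet1x.
Qed.

End ProductFilter.

(** * Interiors in pretopological groups *)

Section Interior.
Context d (L : completeResiduatedLatticeType d) (X : Type).
Variable C : topConvergence L X.
Implicit Types (l m : X -> L) (x z : X).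

Definition interior l z : L :=
  csup [set subsethood m l | m in topFilter_set (nbhdFilter C z)].

Lemma nbhd_top x m : nbhdFilter C x m -> m x = \top.
Proof. by move/(_ _ (conv_point C x)). Qed.

Lemma interior_le l : interior l <= l.
Proof.
apply/lefP => z; apply: csup_le => _ [m /nbhd_top mz <-].
by rewrite -[leLHS]tensor1l -mz tensor_subsethood.
Qed.

(** The residual [a -> l], with [a] the degree of interiority of [z], is a
neighbourhood realising the supremum that defines [a]. *)
Lemma interior_attained l z : is_MV L ->
  exists2 m, nbhdFilter C z m & interior l z <= subsethood m l.
Proof.
move=> MV; exists (fun x => residuum (interior l z) (l x)); last first.
  by apply/subsethoodP => x; rewrite tensorC tensor_residuum.
have nonempty :
    [set subsethood m l | m in topFilter_set (nbhdFilter C z)] !=set0.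
  by have [m Um] := topFilter_neq0 (nbhdFilter C z); exists (subsethood m l), m.
apply: topFilter_sat.
apply: csup_eq1 (residuum_sup_top MV nonempty (lexx (interior l z))).
move=> _ [_ [m Um <-] <-]; eexists; first by exists m.
exact: residuum_subsethood.
Qed.

End Interior.

Section Group.
Context d (L : completeResiduatedLatticeType d) (X : groupType).
Variable C : topConvergence L X.
Hypothesis pretop : is_pretopological C.
Hypothesis mul_cont :
  topContinuous (prodConvergence C C) C (fun p : X * X => (p.1 * p.2)%g).

(** Left translation by [z^-1] is the restriction of multiplication to the
slice [{z^-1} * X], and the slice embedding is continuous because the point
filter at [z^-1] converges. *)
Lemma nbhd_translate z n :
  nbhdFilter C 1%g n -> nbhdFilter C z (fun y => n (z^-1 * y)%g).
Proof.
move=> Un; pose slice y : X * X := (z^-1, y)%g.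
have slice_conv : prodConvergence C C
    (imageFilter slice (nbhdFilter C z)) (slice z).
  split; last exact: conv_subset (pretop z).
  apply: conv_subset (conv_point C z^-1%g) => m /= mz.
  have -> : (m \o fst) \o slice = fun=> \top by apply/funext => y /=.
  exact: (topFilter_top (nbhdFilter C z)).
by have := mul_cont slice_conv; rewrite /= mulVg => /Un.
Qed.

Lemma nbhd_mul x l : nbhdFilter C x l ->
  productFilter (nbhdFilter C x) (nbhdFilter C 1%g)
    (fun p : X * X => l (p.1 * p.2)%g).
Proof.
move=> Ul; set F := productFilter _ _.
have F_conv : prodConvergence C C F (x, 1%g).
  split; first exact: conv_subset (@productFilter_fst _ _ _ _ _ _) _ (pretop x).
  exact: conv_subset (@productFilter_snd _ _ _ _ _ _) _ (pretop _).
by have := mul_cont F_conv; rewrite /= mulg1 => /Ul.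
Qed.

Lemma interior_nbhd x l : nbhdFilter C x l -> nbhdFilter C x (interior C l).
Proof.
move=> /nbhd_mul lmul; apply: topFilter_sat; apply: csup_eq1 lmul.
move=> _ [_ [m Um [n Un <-]] <-]; set c := subsethood _ _.
exists (subsethood m (interior C l)); first by exists m.
apply/subsethoodP => z; set n' := fun y => n (z^-1 * y)%g.
apply: (@le_trans _ _ (subsethood n' l)); last first.
  by apply: csup_ub; exists n' => //; exact: nbhd_translate.
apply/subsethoodP => y; rewrite tensorA.
have := tensor_subsethood (rectangle m n) (fun p => l (p.1 * p.2)%g)
  (z, z^-1 * y)%g.
(* At [(z, z^-1 * y)] the product is [y], and the tensor [m z * n (z^-1 * y)]
   lies below the meet defining the rectangle, which allows currying. *)
rewrite rectangleE /= mulVKg; apply: le_trans.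
by apply: le_tensor => //; rewrite lexI tensor_lel tensor_ler.
Qed.

End Group.

Theorem theorem4p5 (d : Order.disp_t) (L : completeResiduatedLatticeType d)
  (X : groupType) (C : topConvergence L X) :
  is_pretopologicalGroup C -> is_MV L -> is_topological C.
Proof.
move=> [[mul_cont _] pretop] MV; split=> // x l Ul.
exists (interior C l); split; first exact: interior_nbhd.
  exact: interior_le.
by move=> z; exact: interior_attained.
Qed.
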